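(* Let $d\in\mathbb N$ and let $X_1,X_2,\dots$ be i.i.d. uniformly distributed on $Q_1=[-1/2,1/2)^d$, with $\mathcal X_n:=\{X_1,\dots,X_n\}$. Let $(r_n)_{n\ge1}$ be a sequence of positive reals with $r_n\to0$ and $nr_n^d\to\infty$ as $n\to\infty$. Then $$r_n^d\,\gamma(G(\mathcal X_n,r_n))\to\overline\kappa\quad\text{almost surely as }n\to\infty.$$
   Context: $G(\mathcal X,r)$ is the graph on vertex set $\mathcal X\subset\mathbb R^d$ with an edge between distinct points at Euclidean distance at most $r$. For a finite graph $G$, $\gamma(G)$ is the domination number: the minimum size of a set $A$ of vertices such that every vertex is in $A$ or adjacent to an element of $A$. Let $B_1(x)$ be the closed Euclidean unit ball centred at $x$ and $Q_s:=[-s/2,s/2)^d$. For bounded Borel $A\subset\mathbb R^d$, $\kappa(A):=\inf\{|\mathcal X|:\mathcal X\subset\mathbb R^d,\ |\mathcal X|<\infty,\ A\subset\bigcup_{x\in\mathcal X}B_1(x)\}$, and $\overline\kappa:=\lim_{s\to\infty}s^{-d}\kappa(Q_s)=\inf_{s\ge1}s^{-d}\kappa(Q_s)$ (this limit exists and equals the infimum). *)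

(* Defs.v *)
From HB Require Import structures.
From mathcomp Require Import all_boot all_order all_algebra finmap.
From mathcomp Require Import all_classical all_reals all_analysis.

Set Implicit Arguments.
Unset Strict Implicit.
Unset Printing Implicit Defensive.

Import Order.TTheory GRing.Theory Num.Theory.
Import numFieldNormedType.Exports.

Local Open Scope classical_set_scope.
Local Open Scope ring_scope.

Section domination.
Variables (V : finType) (adj : rel V).

Definition dominating (A : {set V}) : bool :=
  [forall v, (v \in A) || [exists u in A, adj u v]].

(* The arg min starts from the set of all vertices, which is dominating. *)
Definition domination_number : nat :=
  #|[arg min_(A < finset.setTfor V | dominating A) #|A|]%N|.

Lemma domination_numberP :
  (exists2 A : {set V}, dominating A & #|A| = domination_number) /\
  (forall A : {set V}, dominating A -> (domination_number <= #|A|)%N).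
Proof.
rewrite /domination_number; case: arg_minnP => [|A domA minA].
  by apply/forallP => v; rewrite finset.in_setT.
by split=> //; exists A.
Qed.

End domination.

(* Points of R^d are d-tuples: the library equips these with the product
   sigma-algebra, which is the Borel one, whereas 'rV[R]_d has no measurable
   structure and its library norm is the sup norm. *)
Section euclidean.
Variables (R : realType) (d : nat).
Implicit Types (x y : d.-tuple R) (r s : R) (X : {fset d.-tuple R}).

Definition edist x y : R :=
  Num.sqrt (\sum_(i < d) (tnth x i - tnth y i) ^+ 2).

Definition unit_ball x : set (d.-tuple R) := [set y | edist x y <= 1].

Definition cube s : set (d.-tuple R) :=
  [set x | forall i, - (s / 2) <= tnth x i < s / 2].

Definition geom_adj X r : rel X :=
  fun u v => (u != v) && (edist (val u) (val v) <= r).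

Definition geom_domination X r : nat := domination_number (@geom_adj X r).

Definition kappa (A : set (d.-tuple R)) : R :=
  inf [set (#|` X|)%:R | X in
    [set X : {fset d.-tuple R} | A `<=` \bigcup_(x in [set` X]) unit_ball x]].

Definition kappa_bar : R := lim (s ^- d * kappa (cube s) @[s --> +oo]).

End euclidean.

Section lebesgue_cons.
Local Open Scope ereal_scope.
Variables (R : realType) (d : nat).
Variable mu : {sigma_finite_measure set (d.-tuple R) -> \bar R}.

Let cons_pair (p : R * d.-tuple R) : d.+1.-tuple R := [tuple of p.1 :: p.2].

Let measurable_cons_pair : measurable_fun setT cons_pair.
Proof. exact: measurable_cons. Qed.

Definition lebesgue_cons : set (d.+1.-tuple R) -> \bar R :=
  pushforward (@lebesgue_measure R \x mu) cons_pair.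

Let lebesgue_cons0 : lebesgue_cons set0 = 0.
Proof. by rewrite /lebesgue_cons /pushforward preimage_set0 measure0. Qed.

Let lebesgue_cons_ge0 A : 0 <= lebesgue_cons A.
Proof. exact: measure_ge0. Qed.

Let lebesgue_cons_sigma_additive : semi_sigma_additive lebesgue_cons.
Proof.
move=> F mF tF mUF; rewrite /lebesgue_cons /pushforward preimage_bigcup.
apply: measure_semi_sigma_additive.
- by move=> n; rewrite -[X in measurable X]setTI; exact: measurable_cons_pair.
- apply/trivIsetP => /= i j _ _ ij; rewrite -preimage_setI.
  by move/trivIsetP : tF => /(_ _ _ _ _ ij) ->//; rewrite preimage_set0.
- rewrite -preimage_bigcup -[X in measurable X]setTI.
  exact: measurable_cons_pair.
Qed.

HB.instance Definition _ := isMeasure.Build _ _ _ lebesgue_cons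
  lebesgue_cons0 lebesgue_cons_ge0 lebesgue_cons_sigma_additive.

Let lebesgue_cons_sigma_finite : sigma_finite setT lebesgue_cons.
Proof.
pose un (x : d.+1.-tuple R) : R * d.-tuple R := (thead x, [tuple of behead x]).
have unK p : un (cons_pair p) = p.
  by case: p => a t; congr pair; apply/val_inj.
have mun : measurable_fun setT un.
  apply: measurable_fun_pair; last exact: measurable_behead.
  exact: measurable_tnth.
have /sigma_finiteP[F [FT ndF Ffin]] := sigma_finiteT (@lebesgue_measure R).
have /sigma_finiteP[G [GT ndG Gfin]] := sigma_finiteT mu.
exists (fun n => un @^-1` (F n `*` G n)).
  rewrite -preimage_bigcup (_ : \bigcup_n _ = setT) ?preimage_setT//.
  rewrite -subTset => -[x y] _.
  have [n _ Fnx] : (\bigcup_n F n) x by rewrite -FT.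
  have [k _ Gky] : (\bigcup_n G n) y by rewrite -GT.
  exists (maxn n k) => //; split => /=.
    by move: x Fnx; exact/subsetPset/ndF/leq_maxl.
  by move: y Gky; exact/subsetPset/ndG/leq_maxr.
move=> n; have [mF Foo] := Ffin n; have [mG Goo] := Gfin n; split.
  by rewrite -[X in measurable X]setTI; apply: mun => //; exact: measurableX.
rewrite /lebesgue_cons /pushforward (_ : _ @^-1` _ = F n `*` G n); last first.
  by apply/funext => p; exact: (congr1 (F n `*` G n) (unK p)).
by rewrite product_measure1E// lte_mul_pinfty// ge0_fin_numE.
Qed.

HB.instance Definition _ := Measure_isSigmaFinite.Build _ _ _ lebesgue_cons
  lebesgue_cons_sigma_finite.

End lebesgue_cons.

(* d-dimensional Lebesgue measure on Borel sets: the d-fold product of the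
   one-dimensional one, transported along R * R^d = R^(d+1). *)
Fixpoint lebesgue_tuple (R : realType) (d : nat) :
    {sigma_finite_measure set (d.-tuple R) -> \bar R} :=
  match d with
  | 0 => \d_([tuple] : 0.-tuple R)
  | d'.+1 => lebesgue_cons (lebesgue_tuple R d')
  end.

Lemma lebesgue_tuple_box (R : realType) (d : nat) (A : 'I_d -> set R) :
  (forall i, measurable (A i)) ->
  lebesgue_tuple R d [set x | forall i, A i (tnth x i)] =
  (\prod_(i < d) lebesgue_measure (A i))%E.
Proof.
elim: d A => [|d IH] A mA.
  rewrite big_ord0/= diracE mem_set//= => -[]//.
rewrite big_ord_recl -IH//= /lebesgue_cons /pushforward.
rewrite -product_measure1E; [|exact: mA|].
- congr (product_measure1 _ _ _); apply/seteqP; split => -[a t] /= h.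
    split; first by have := h ord0; rewrite tnth0.
    by move=> i; have := h (lift ord0 i); rewrite tnthS.
  move=> i; case: (unliftP ord0 i) => [j ->|->].
    by rewrite tnthS; exact: h.2.
  by rewrite tnth0; exact: h.1.
- rewrite (_ : [set _ | _] =
      \big[setI/setT]_(i < d) ((@tnth d R ^~ i) @^-1` (A (lift ord0 i)))).
    apply: bigsetI_measurable => i _.
    by rewrite -[X in measurable X]setTI; exact: measurable_tnth.
  rewrite -bigcap_seq; apply/seteqP; split => x /= h.
    by move=> i _; exact: h.
  by move=> i; apply: (h i); rewrite /= mem_index_enum.
Qed.

Lemma lebesgue_tuple_cube1 (R : realType) (d : nat) :
  lebesgue_tuple R d (cube 1) = 1%E.
Proof.
pose I := [set` `[- (1 / 2), 1 / 2[] : set R.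
have -> : cube 1 = [set x : d.-tuple R | forall i, I (tnth x i)].
  by apply/seteqP; split => x /= h i; have := h i; rewrite /I /= in_itv.
rewrite (lebesgue_tuple_box (fun=> measurable_itv _)) big1// => i _.
rewrite lebesgue_measure_itv/= lte_fin gtrN ?divr_gt0//.
by rewrite -EFinB opprK -splitr.
Qed.

Section random_vectors.
Variables (dO : measure_display) (Omega : measurableType dO) (R : realType).
Variable P : probability Omega R.

Definition uniform_on (d : nat) (X : {RV P >-> d.-tuple R})
    (Q : set (d.-tuple R)) : Prop :=
  forall B, measurable B ->
    distribution P X B = (lebesgue_tuple R d (B `&` Q) / lebesgue_tuple R d Q)%E.

Definition mutually_independent (dT : measure_display) (T : measurableType dT)
    (X : nat -> {RV P >-> T}) : Prop :=
  forall (J : {fset nat}) (B : nat -> set T), (forall i, measurable (B i)) ->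
    P (\bigcap_(i in [set` J]) (X i @^-1` B i)) =
    (\prod_(i <- J) P (X i @^-1` B i))%E.

(* With X 0, X 1, ... standing for X_1, X_2, ..., this is {X_1, ..., X_n}. *)
Definition sample (d : nat) (X : nat -> {RV P >-> d.-tuple R}) (n : nat)
    (w : Omega) : {fset d.-tuple R} :=
  [fset X (val i) w | i in 'I_n]%fset.

End random_vectors.

(* Main.v *)
Require Import Defs.
From mathcomp Require Import all_boot all_order all_algebra finmap.
From mathcomp Require Import all_classical all_reals all_analysis.
From mathcomp Require Import ring lra zify.

(**
Cut the unit cube into [M ^ d] cells of diameter at most [eta * r], where
[M ~ d / (eta * r)].  A set of [k] cells misses [n] uniform points with
probability at most [exp (- k n / M ^ d)], so by a union bound over the
[2 ^ (M ^ d)] sets of cells and [M ^ d = o(n)], at least [eps * M ^ d] cells are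
empty with probability at most [exp (- eps n / 2)] for large [n]; by
Borel-Cantelli, almost surely a vanishing proportion of the cells is empty.

Moving points within their cells costs a distance [eta * r].  Hence a dominating
set together with the centres of the empty cells covers the cube by balls of
radius [(1 + eta) * r].  Conversely, take a cover of the cube by balls of radius
[(1 - eta) * r] and replace each centre by a sample point of the nearest cell if
that cell is not empty, and otherwise by one sample point of each of the
boundedly many cells within reach; the result is dominating.  So the domination
number is, up to [o(r ^ - d)], between the covering numbers of cubes of side
[1 / ((1 + eta) * r)] and [1 / ((1 - eta) * r)].
*)

Set Implicit Arguments.
Unset Strict Implicit.
Unset Printing Implicit Defensive.

Import Order.TTheory GRing.Theory Num.Theory.
Import numFieldNormedType.Exports.

Local Open Scope classical_set_scope.
Local Open Scope ring_scope.

(* Unqualified, [edist] is the extended distance of MathComp-Analysis. *)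
Local Notation edist := Defs.edist.

(** * Euclidean distance and covers of cubes *)

Section Euclidean_distance.
Context {R : realType} {d : nat}.
Implicit Types (a b : 'I_d -> R) (x y u v : d.-tuple R).

Let l2 a : R := Num.sqrt (\sum_i a i ^+ 2).

Let l2_sqr a : l2 a ^+ 2 = \sum_i a i ^+ 2.
Proof. by rewrite sqr_sqrtr// sumr_ge0// => i _; rewrite sqr_ge0. Qed.

Let cauchy_schwarz_sum a b : \sum_i a i * b i <= l2 a * l2 b.
Proof.
suff : (\sum_i a i * b i) ^+ 2 <= (l2 a * l2 b) ^+ 2.
  move=> le2; rewrite (le_trans (ler_norm _))//.
  rewrite -(ger0_norm (mulr_ge0 (sqrtr_ge0 _) (sqrtr_ge0 _))).
  by rewrite -ler_sqr ?nnegrE// !real_normK// num_real.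
rewrite exprMn !l2_sqr.
(* Lagrange's identity: this double sum is twice the gap in the Cauchy-Schwarz inequality. *)
have : 0 <= \sum_i \sum_j (a i * b j - a j * b i) ^+ 2.
  by apply: sumr_ge0 => i _; apply: sumr_ge0 => j _; rewrite sqr_ge0.
pose A := \sum_i a i ^+ 2; pose B := \sum_i b i ^+ 2.
pose C := \sum_i a i * b i.
rewrite (_ : \sum_i _ = A * B + A * B - 2 * C ^+ 2).
  by rewrite -/A -/B -/C; lra.
have sumM (f g : 'I_d -> R) :
    (\sum_i f i) * (\sum_i g i) = \sum_i \sum_j f i * g j.
  by rewrite mulr_suml; apply: eq_bigr => i _; rewrite mulr_sumr.
rewrite -{1}[A * B]mulrC [B * A]sumM [A * B]sumM expr2 [C * C]sumM.
rewrite mulr_sumr -big_split -sumrB/=; apply: eq_bigr => i _.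
rewrite mulr_sumr -big_split -sumrB/=; apply: eq_bigr => j _.
by ring.
Qed.

Let l2_triangle a b : l2 (fun i => a i + b i) <= l2 a + l2 b.
Proof.
rewrite -ler_sqr ?nnegrE ?addr_ge0 ?sqrtr_ge0// sqrrD !l2_sqr.
under eq_bigr do rewrite sqrrD.
rewrite 2!big_split/= lerD2r lerD2l sumrMnl lerMn2r.
exact: cauchy_schwarz_sum.
Qed.

Let l2_mono a b : (forall i, `|a i| <= b i) -> l2 a <= l2 b.
Proof.
move=> ab; rewrite ler_wsqrtr// ler_sum// => i _.
by rewrite -real_normK ?num_real// ler_sqr ?nnegrE// (le_trans _ (ab i)).
Qed.

Let l2_cst (e : R) : 0 <= e -> l2 (fun=> e) <= d%:R * e.
Proof.
move=> e0; rewrite /l2 sumr_const card_ord -[_ *+ d]mulr_natl.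
rewrite -ler_sqr ?nnegrE ?mulr_ge0 ?sqrtr_ge0// sqr_sqrtr ?mulr_ge0 ?sqr_ge0//.
rewrite exprMn ler_wpM2r ?sqr_ge0// -natrX ler_nat.
by case: (d) => [//|k]; rewrite leq_pmulr.
Qed.

Lemma edistxx x : edist x x = 0.
Proof. by rewrite /edist big1 ?sqrtr0// => i _; rewrite subrr expr0n. Qed.

(** Minkowski's inequality, with the crude bound [d * e] for the norm of a constant vector. Every
    displacement within a grid cell is paid for by this estimate, with [e] equal to [M%:R^-1]. *)
Lemma edist_perturb x y u v (e : R) : 0 <= e ->
  (forall i, `|tnth x i - tnth y i| <= `|tnth u i - tnth v i| + e) ->
  edist x y <= edist u v + d%:R * e.
Proof.
move=> e0 xyuv.
have -> : edist u v = l2 (fun i => `|tnth u i - tnth v i|).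
  by rewrite /edist /l2; congr Num.sqrt; apply: eq_bigr => i _;
     rewrite real_normK ?num_real.
rewrite (le_trans (l2_mono xyuv))// (le_trans (l2_triangle _ _))//.
by rewrite lerD2l l2_cst.
Qed.

Lemma edist_coord x y i : `|tnth x i - tnth y i| <= edist x y.
Proof.
rewrite -ler_sqr ?nnegrE ?sqrtr_ge0// real_normK ?num_real// l2_sqr.
rewrite (bigD1 i)//= lerDl sumr_ge0// => j _; exact: sqr_ge0.
Qed.

Lemma edist_scale (k : R) x y u v : 0 <= k ->
  (forall i, tnth u i - tnth v i = k * (tnth x i - tnth y i)) ->
  edist u v = k * edist x y.
Proof.
move=> k0 uv; rewrite /edist; under eq_bigr do rewrite uv exprMn.
by rewrite -mulr_sumr sqrtrM ?sqr_ge0// sqrtr_sqr ger0_norm.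
Qed.

(** Centres form a list, so that they can be mapped and concatenated without regard to repetitions.
    The free radius allows passing between small balls in the unit cube and unit balls in a large
    cube. *)
Definition covers (s rho : R) (ys : seq (d.-tuple R)) : Prop :=
  forall x, cube s x -> exists2 y, y \in ys & edist y x <= rho.

Lemma covers_scale (k s rho : R) ys : 0 < k -> covers s rho ys ->
  covers (k * s) (k * rho)
    [seq [tuple k * tnth y i | i < d] | y : d.-tuple R <- ys].
Proof.
move=> k0 cov x xks.
have [|y yys yx] := cov [tuple tnth x i / k | i < d].
  move=> i; rewrite tnth_mktuple ler_pdivlMr// ltr_pdivrMr//.
  by have := xks i; rewrite (_ : k * s / 2 = s / 2 * k) ?mulNr//; ring.
exists [tuple k * tnth y i | i < d]; first exact: map_f.
rewrite (@edist_scale k y [tuple tnth x i / k | i < d]) ?ler_pM2l ?(ltW k0)//.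
move=> i.
by rewrite !tnth_mktuple mulrBr (mulrC (tnth x i)) mulVKf// gt_eqF.
Qed.

Lemma kappa_le (s : R) ys : covers s 1 ys ->
  kappa (cube s : set (d.-tuple R)) <= (size ys)%:R.
Proof.
move=> cov; apply: (@le_trans _ _ (#|` [fset y in ys]%fset|)%:R); last first.
  by rewrite ler_nat card_fseq size_undup.
apply: ge_inf; first by exists 0 => _ [X _ <-]; rewrite ler0n.
exists [fset y in ys]%fset => //= x /cov[y yys yx].
by exists y => //=; rewrite inE.
Qed.


(** * Grid cells of the unit cube *)

Lemma grid_index (M : nat) (x : R) : (0 < M)%N -> - (1 / 2) <= x < 1 / 2 ->
  exists j : 'I_M, j%:R <= (x + 1 / 2) * M%:R < j.+1%:R.
Proof.
move=> M0 /andP[x1 x2]; set t := (_ * _).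
have M0' : 0 < M%:R :> R by rewrite ltr0n.
have t0 : 0 <= t by rewrite mulr_ge0 ?ler0n//; lra.
have tM : (Num.truncn t < M)%N.
  by rewrite truncn_lt_nat// -[ltRHS]mul1r ltr_pM2r//; lra.
by exists (Ordinal tM); exact: truncn_itv.
Qed.

(** Half-open like [cube], so that the cells partition [cube 1]; the index [c i] is the integer part
    of the rescaled coordinate. *)
Definition in_cell (M : nat) (c : {ffun 'I_d -> 'I_M}) x : bool :=
  [forall i, (c i)%:R <= (tnth x i + 1 / 2) * M%:R < (c i).+1%:R].

Definition cell_center (M : nat) (c : {ffun 'I_d -> 'I_M}) : d.-tuple R :=
  [tuple ((c i)%:R + 1 / 2) / M%:R - 1 / 2 | i < d].

Lemma cell_exists (M : nat) x : (0 < M)%N -> cube 1 x ->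
  exists c : {ffun 'I_d -> 'I_M}, in_cell c x.
Proof.
move=> M0 x1.
have /(_ _)/cid-/all_sig[f fP] : forall i, exists j : 'I_M,
    j%:R <= (tnth x i + 1 / 2) * M%:R < j.+1%:R.
  by move=> i; exact/grid_index/x1.
by exists [ffun i => f i]; apply/forallP => i; rewrite ffunE.
Qed.

Lemma in_cell_center (M : nat) (c : {ffun 'I_d -> 'I_M}) :
  (0 < M)%N -> in_cell c (cell_center c).
Proof.
move=> M0; apply/forallP => i; rewrite tnth_mktuple subrK.
by rewrite divfK ?pnatr_eq0 -?lt0n// -[in ltRHS]natr1; apply/andP; split; lra.
Qed.

Lemma in_cell_dist (M : nat) (c : {ffun 'I_d -> 'I_M}) x y :
  (0 < M)%N -> in_cell c x -> in_cell c y ->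
  forall i, `|tnth x i - tnth y i| <= M%:R^-1.
Proof.
move=> M0 /forallP cx /forallP cy i.
have M0' : 0 < M%:R :> R by rewrite ltr0n.
rewrite -(ler_pM2r M0') mulVf ?gt_eqF// -{1}(gtr0_norm M0') -normrM.
have /andP[x1 x2] := cx i; have /andP[y1 y2] := cy i.
rewrite -[in ltRHS]natr1 in x2; rewrite -[in ltRHS]natr1 in y2.
rewrite ler_norml.
by apply/andP; split; lra.
Qed.

(** * Finiteness, attainment and subadditivity of covering numbers *)

Lemma kappa_has_cover (s : R) : 0 < s -> exists ys, covers s 1 ys.
Proof.
(* As [M] exceeds [d * s], the grid cover of radius [d / M], scaled by [s], has radius below 1. *)
move=> s0; pose M := (Num.truncn (d%:R * s)).+1.
have M0 : (0 < M)%N by [].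
have [ys ysM] : exists ys, covers 1 (d%:R / M%:R) ys.
  exists [seq cell_center c | c <- enum {ffun 'I_d -> 'I_M}] => x.
  move=> /(cell_exists M0)[c cx]; exists (cell_center c).
    by rewrite map_f// mem_enum.
  rewrite -[leRHS]add0r -(edistxx x) edist_perturb ?invr_ge0// => i.
  by rewrite subrr normr0 add0r (in_cell_dist M0 (in_cell_center c M0) cx).
exists [seq [tuple s * tnth y i | i < d] | y : d.-tuple R <- ys].
have := covers_scale s0 ysM; rewrite mulr1 => cov x /cov[y yys yx].
exists y => //; rewrite (le_trans yx)// mulrCA mulrA ler_pdivrMr ?ltr0n//.
rewrite mul1r ltW//.
have /andP[_] : (Num.truncn (d%:R * s))%:R <= d%:R * s < M%:R.
  by rewrite truncn_itv// mulr_ge0// ltW.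
by [].
Qed.

(** The infimum is over a nonempty set of natural numbers, hence a minimum. From here on [kappa] can
    be traded for an actual list of centres. *)
Lemma kappa_attained (s : R) : 0 < s ->
  exists2 ys, covers s 1 ys & (size ys)%:R = kappa (cube s : set (d.-tuple R)).
Proof.
move=> s0.
pose Q n := `[< exists2 ys, covers s 1 ys & size ys = n >].
have exQ : exists n, Q n.
  have [ys ?] := kappa_has_cover s0.
  by exists (size ys); apply/asboolP; exists ys.
case: (ex_minnP exQ) => n /asboolP[ys ysc ysn] nmin; exists ys => //.
apply/eqP; rewrite eq_le kappa_le// andbT ysn; apply: lb_le_inf.
  exists (#|` [fset y in ys]%fset|)%:R, [fset y in ys]%fset => //= x.
  move=> /ysc[y yys yx].
  by exists y => //=; rewrite inE.
move=> _ [X /= cX <-]; rewrite ler_nat nmin//; apply/asboolP.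
by exists X => // x /cX[y yX yx]; exists y.
Qed.

(** Cut the cube of side [t] into [M ^ d] cells of side [t / M <= s] and cover each by a translate
    of one optimal cover of [cube s]. *)
Lemma kappa_subadditive (s t : R) (M : nat) : 0 < s -> 0 < t -> (0 < M)%N ->
  t <= M%:R * s -> kappa (cube t : set (d.-tuple R)) <=
    (M ^ d)%:R * kappa (cube s : set (d.-tuple R)).
Proof.
move=> s0 t0 M0 tMs; have [ys ysc <-] := kappa_attained s0.
have M0' : 0 < M%:R :> R by rewrite ltr0n.
rewrite -natrM.
pose zs := [seq [tuple tnth y i + t * tnth (cell_center c) i | i < d]
  | c : {ffun 'I_d -> 'I_M} <- enum {ffun 'I_d -> 'I_M},
    y : d.-tuple R <- ys].
have -> : (M ^ d * size ys)%N = size zs.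
  by rewrite size_allpairs -cardE card_ffun !card_ord.
apply: kappa_le => x xt.
have [|c /forallP cx] := @cell_exists M [tuple tnth x i / t | i < d] M0.
  move=> i; rewrite tnth_mktuple ler_pdivlMr// ltr_pdivrMr//.
  by have /andP[] := xt i; rewrite -mulNr; lra.
have [|y yys yx] := ysc [tuple tnth x i - t * tnth (cell_center c) i | i < d].
  move=> i; have := cx i; rewrite !tnth_mktuple.
  set xi := tnth x i; set ci := (c i)%:R.
  (* The offset from the cell centre is [t / M] times a number in [[-1/2, 1/2)]. *)
  have -> : xi - t * ((ci + 1 / 2) / M%:R - 1 / 2) =
      t / M%:R * ((xi / t + 1 / 2) * M%:R - (ci + 1 / 2)).
    by field; rewrite !gt_eqF.
  rewrite -[in X in _ < X]natr1 => /andP[h1 h2].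
  have tM : t / M%:R <= s by rewrite ler_pdivrMr// mulrC.
  have tM0 : 0 < t / M%:R by rewrite divr_gt0.
  by apply/andP; split; nra.
exists [tuple tnth y i + t * tnth (cell_center c) i | i < d].
  by apply: allpairs_f => //; rewrite mem_enum.
rewrite (le_trans _ yx)// -[leRHS]mul1r.
rewrite -(edist_scale (k := 1) (x := y)
  (y := [tuple tnth x i - t * tnth (cell_center c) i | i < d]) (v := x)
  (u := [tuple tnth y i + t * tnth (cell_center c) i | i < d])) // => i.
by rewrite !tnth_mktuple; ring.
Qed.

End Euclidean_distance.

(** * Existence of the limiting covering density *)

Section kappa_limit.
Context (R : realType) (d : nat).

(** A Fekete-type argument: subadditivity gives [f t <= (1 + s / t) ^+ d * f s], so [f] tends to its
    infimum over positive [s]. This makes the [lim] in [kappa_bar] a genuine limit. *)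
Lemma cvg_kappa_bar :
  s ^- d * kappa (cube s : set (d.-tuple R)) @[s --> +oo] --> kappa_bar R d.
Proof.
pose f s : R := s ^- d * kappa (cube s : set (d.-tuple R)).
rewrite -[X in X @ _]/f.
suff [L fL] : exists L : R, f s @[s --> +oo] --> L.
  by rewrite /kappa_bar (cvg_lim _ fL).
have f_ge0 s : 0 < s -> 0 <= f s.
  move=> s0; have [ys _ sz] := @kappa_attained R d _ s0.
  by rewrite /f -sz mulr_ge0 ?invr_ge0 ?exprn_ge0// ltW.
pose A := [set f s | s in [set s | 0 < s]].
have hA : has_inf A.
  split; first by exists (f 1), 1 => //=.
  by exists 0 => _ [s /= s0 <-]; exact: f_ge0.
exists (inf A); apply/cvgrPdist_le => e e0.
have [_ [s /= s0 <-] fs] := inf_adherent e0 hA.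
have c1 : 1 + s * t^-1 @[t --> +oo] --> (1 : R).
  rewrite -[X in _ --> X]addr0; apply: cvgD; first exact: cvg_cst.
  rewrite -[X in _ --> X](mulr0 s); apply: cvgM; first exact: cvg_cst.
  by apply/gtr0_cvgV0 => //; apply: nbhs_pinfty_gt; rewrite num_real.
have c2 : (1 + s * t^-1) ^+ d @[t --> +oo] --> (1 ^+ d : R).
  apply: (@continuous_cvg _ _ _ _ _ _ (fun u : R => u ^+ d)) c1.
  exact: exprn_continuous.
have : (1 + s * t^-1) ^+ d * f s @[t --> +oo] --> 1 ^+ d * f s.
  by apply: cvgM c2 _; exact: cvg_cst.
rewrite expr1n mul1r.
move=> /cvgr_lt/(_ _ fs) near_fs.
near=> t.
have t0 : 0 < t by near: t; apply: nbhs_pinfty_gt; rewrite num_real.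
have inf_le : inf A <= f t by apply: ge_inf; [exact: hA.2|exists t].
rewrite ler0_norm ?subr_le0// opprB lerBlDl ltW//.
apply: (@le_lt_trans _ _ ((1 + s * t^-1) ^+ d * f s)); last by near: t.
(* Enough cells per side for [t <= M * s], while [M <= t / s + 1]. *)
pose M := (Num.truncn (t / s)).+1.
have /andP[M1 M2] : (Num.truncn (t / s))%:R <= t / s < M%:R.
  by rewrite truncn_itv// divr_ge0// ltW.
have le_kappa : kappa (cube t : set (d.-tuple R)) <=
    (M ^ d)%:R * kappa (cube s : set (d.-tuple R)).
  by apply: (@kappa_subadditive R d s t M) => //; rewrite -ler_pdivrMr// ltW.
rewrite /f (mulrC (t ^- d)) ler_pdivrMr ?exprn_gt0//.
rewrite (le_trans le_kappa)// mulrA mulrAC ler_wpM2r//.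
  by have [ys _ <-] := @kappa_attained R d _ s0; exact: ler0n.
rewrite natrX -exprVn -!exprMn.
have -> : (1 + s * t^-1) * s^-1 * t = t / s + 1 by field; rewrite !gt_eqF.
rewrite lerXn2r ?nnegrE ?ler0n ?addr_ge0 ?divr_ge0 ?(ltW t0) ?(ltW s0)//.
by rewrite /M -natr1 lerD2r.
Unshelve. all: by end_near. Qed.

End kappa_limit.

(** * Deterministic bounds between domination and covering numbers *)

Section domination_bounds.
Context {R : realType} {d : nat}.
Implicit Types (S : {fset d.-tuple R}) (x y z : d.-tuple R) (M K : nat).

Definition empty_cells S M : {set {ffun 'I_d -> 'I_M}} :=
  [set c | ~~ [exists x : S, in_cell c (val x)]]%SET.

(** A point of an occupied cell is within [d / M] of a sample point, hence within [r + d / M] of the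
    dominating set; a point of an empty cell is within [d / M] of its centre. Scaling by [rho^-1]
    makes the radius 1. *)
Lemma kappa_le_domination S (r rho : R) M : (0 < M)%N -> 0 < r ->
  r + d%:R / M%:R <= rho ->
  kappa (cube rho^-1 : set (d.-tuple R)) <=
    (geom_domination S r + #|empty_cells S M|)%:R.
Proof.
move=> M0 r0 rrho.
have dM0 : 0 <= d%:R / M%:R :> R by rewrite divr_ge0.
have rho0 : 0 < rho by lra.
have [[A domA Acard] _] := domination_numberP (@geom_adj R d S r).
pose ys := [seq val v | v <- enum A] ++
           [seq cell_center c | c <- enum (empty_cells S M)].
have -> : (geom_domination S r + #|empty_cells S M|)%N =
    size [seq [tuple rho^-1 * tnth y i | i < d] | y : d.-tuple R <- ys].
  by rewrite size_map size_cat !size_map -!cardE Acard.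
suff /(@covers_scale _ _ rho^-1) : covers 1 rho ys.
  by rewrite invr_gt0 mulr1 mulVf ?gt_eqF// => /(_ rho0)/kappa_le.
move=> x x1.
have [c cx] := cell_exists M0 x1.
have [cE|] := boolP (c \in empty_cells S M).
  exists (cell_center c).
    by rewrite mem_cat; apply/orP; right; rewrite map_f// mem_enum.
  rewrite (@le_trans _ _ (edist x x + d%:R * M%:R^-1))//; last first.
    by rewrite edistxx; lra.
  apply: edist_perturb; first by rewrite invr_ge0.
  move=> i; rewrite subrr normr0 add0r.
  exact: (in_cell_dist M0 (in_cell_center c M0) cx).
rewrite inE negbK => /existsP[z cz].
have [u uA uz] : exists2 u, u \in A & edist (val u) (val z) <= r.
  have /forallP/(_ z)/orP[zA|/existsP[u /andP[uA /andP[_ uz]]]] := domA.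
    by exists z => //; rewrite edistxx ltW.
  by exists u.
exists (val u); first by rewrite mem_cat map_f// mem_enum.
apply: (@le_trans _ _ (edist (val u) (val z) + d%:R * M%:R^-1)); last lra.
apply: edist_perturb; first by rewrite invr_ge0.
move=> i; have := in_cell_dist M0 cz cx i.
have := ler_normD (tnth (val u) i - tnth (val z) i) (tnth (val z) i - tnth x i).
by rewrite addrA subrK; lra.
Qed.

(* Stands in for the projection onto the cube, as [y] may lie outside of it. *)
Lemma nearest_index M (y : R) : (0 < M)%N -> exists j : 'I_M, forall x z : R,
  j%:R <= (x + 1 / 2) * M%:R < j.+1%:R -> - (1 / 2) <= z < 1 / 2 ->
  `|x - z| <= `|y - z| + M%:R^-1.
Proof.
move=> M0; have M0' : 0 < M%:R :> R by rewrite ltr0n.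
have bnd (j : nat) (x : R) : j%:R <= (x + 1 / 2) * M%:R < j.+1%:R ->
    j%:R / M%:R <= x + 1 / 2 < j%:R / M%:R + M%:R^-1.
  rewrite -{3}[M%:R^-1]mul1r -mulrDl natr1.
  by rewrite ler_pdivrMr// ltr_pdivlMr.
have M1 : 0 < M%:R^-1 :> R by rewrite invr_gt0.
have [y1|y1] := ltP y (- (1 / 2)).
  exists (Ordinal M0) => x z /bnd /=.
  rewrite mul0r add0r => /andP[x1 x2] /andP[z1 z2].
  have := ler_norm (z - y); rewrite distrC => zy.
  by rewrite ler_norml; apply/andP; split; lra.
have [y2|y2] := ltP y (1 / 2).
  have [|j hj] := @grid_index R M y M0; first by rewrite y1.
  exists j => x z /bnd/andP[x1 x2] _; have /bnd/andP[y3 y4] := hj.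
  have := ler_normD (x - y) (y - z); rewrite addrA subrK => xz.
  have : `|x - y| <= M%:R^-1 by rewrite ler_norml; apply/andP; split; lra.
  lra.
have M1M : (M.-1 < M)%N by rewrite prednK.
exists (Ordinal M1M) => x z /bnd /=.
have -> : M.-1%:R / M%:R = 1 - M%:R^-1 :> R.
  by rewrite -subn1 natrB// mulrBl divff ?gt_eqF// mul1r.
move=> /andP[x1 x2] /andP[z1 z2].
have := ler_norm (y - z) => zy.
by rewrite ler_norml; apply/andP; split; lra.
Qed.

Lemma nearest_cell M y : (0 < M)%N ->
  exists c : {ffun 'I_d -> 'I_M}, forall x z, in_cell c x -> cube 1 z ->
    forall i, `|tnth x i - tnth z i| <= `|tnth y i - tnth z i| + M%:R^-1.
Proof.
move=> M0.
have /(_ _)/cid-/all_sig[f fP] := fun i => nearest_index (tnth y i) M0.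
exists [ffun i => f i] => x z /forallP cx z1 i.
by apply: fP; [have := cx i; rewrite ffunE|exact: z1].
Qed.

(** The offset [o i], at most [2 * K], encodes the displacement [o i - K]. What happens at the
    boundary of the grid is immaterial, as only [shift_surj] is used. *)
Let shift M K (c : {ffun 'I_d -> 'I_M}) (o : {ffun 'I_d -> 'I_K.*2.+1}) :
  {ffun 'I_d -> 'I_M} := [ffun i => insubd (c i) (c i + o i - K)%N].

Let shift_surj M K (c c' : {ffun 'I_d -> 'I_M}) :
  (forall i, (c i <= c' i + K)%N && (c' i <= c i + K)%N) ->
  exists o : {ffun 'I_d -> 'I_K.*2.+1}, c' = shift c o.
Proof.
move=> cc'; exists [ffun i => inord (c' i + K - c i)]; apply/ffunP => i.
have /andP[h1 h2] := cc' i.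
rewrite !ffunE inordK; last by rewrite -addnn; lia.
rewrite (_ : (c i + (c' i + K - c i) - K)%N = c' i); last by lia.
by apply/val_inj; rewrite val_insubd ltn_ord.
Qed.

Lemma domination_le_kappa S (r rho : R) M K : (0 < M)%N -> 0 < rho ->
  [set` S] `<=` cube 1 -> rho + d%:R / M%:R <= r -> r * M%:R + 2 <= K%:R ->
  (geom_domination S r)%:R <= kappa (cube rho^-1 : set (d.-tuple R)) +
    (#|empty_cells S M| * K.*2.+1 ^ d)%:R.
Proof.
move=> M0 rho0 S1 rhor rMK.
have M0' : 0 < M%:R :> R by rewrite ltr0n.
have dM0 : 0 <= d%:R / M%:R :> R by rewrite divr_ge0.
have r0 : 0 <= r by lra.
have rhoV0 : 0 < rho^-1 by rewrite invr_gt0.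
have [ys0 cov0 <-] := @kappa_attained R d _ rhoV0.
have [ys szys cov] : exists2 ys, size ys = size ys0 &
    @covers R d 1 rho ys.
  exists [seq [tuple rho * tnth y i | i < d] | y : d.-tuple R <- ys0].
    by rewrite size_map.
  by have := covers_scale rho0 cov0; rewrite mulfV ?gt_eqF// mulr1.
have /(_ _)/cid-/all_sig[ncell ncellP] := fun y => nearest_cell y M0.
pose rep (c : {ffun 'I_d -> 'I_M}) : option S :=
  [pick v : S | in_cell c (val v)].
have repP c (v : S) : in_cell c (val v) ->
    exists2 v0, rep c = Some v0 & in_cell c (val v0).
  move=> cv; rewrite /rep; case: pickP => [v0 cv0|/(_ v)]; last by rewrite cv.
  by exists v0.
(* The candidate cells; [pmap rep] below drops the empty ones. *)
pose cs := [seq ncell y | y <- ys] ++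
  [seq shift c o | c <- enum (empty_cells S M),
     o <- enum {ffun 'I_d -> 'I_K.*2.+1}].
have -> : (size ys0)%:R + (#|empty_cells S M| * K.*2.+1 ^ d)%:R =
    (size cs)%:R :> R.
  rewrite size_cat size_map size_allpairs -!cardE card_ffun !card_ord szys.
  by rewrite natrD.
pose A : {set S} := [set v | v \in pmap rep cs]%SET.
have [_ domle] := domination_numberP (@geom_adj R d S r).
rewrite ler_nat (@leq_trans #|A|)//; last first.
  rewrite cardsE (leq_trans (card_size _))// size_pmap.
  exact: count_size.
apply: domle; apply/forallP => z.
(* Adjacency requires distinct vertices, so [v = z] is treated apart. *)
have dom (v : S) : v \in A -> edist (val v) (val z) <= r ->
    (z \in A) || [exists u in A, geom_adj r u z].
  move=> vA vz; have [zv|zv] := eqVneq v z; first by rewrite -zv vA.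
  by apply/orP; right; apply/existsP; exists v; rewrite vA /geom_adj zv.
have z1 : cube 1 (val z) by apply: S1; exact: valP.
have [y yys yz] := cov _ z1.
have [cE|] := boolP (ncell y \in empty_cells S M); last first.
  rewrite inE negbK => /existsP[v /repP[v0 v0r cv0]].
  apply: (dom v0).
    rewrite inE mem_pmap; apply/mapP; exists (ncell y) => //.
    by rewrite mem_cat map_f.
  apply: (@le_trans _ _ (edist y (val z) + d%:R * M%:R^-1)); last lra.
  apply: edist_perturb; first by rewrite invr_ge0.
  by move=> i; apply: ncellP.
(* The nearest cell is empty. The cell of [z] is not, its representative is within [d / M <= r] of
   [z], and it remains to see that this cell is a shift of the nearest one. *)
have [c cz] := cell_exists M0 z1.
have [v0 v0r cv0] := repP _ _ cz.
apply: (dom v0); last first.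
  apply: (@le_trans _ _ (edist (val z) (val z) + d%:R * M%:R^-1)).
    apply: edist_perturb; first by rewrite invr_ge0.
    by move=> i; rewrite subrr normr0 add0r; exact: in_cell_dist cv0 cz i.
  by rewrite edistxx; lra.
rewrite inE mem_pmap; apply/mapP; exists c => //.
rewrite mem_cat; apply/orP; right.
have [|o ->] := @shift_surj M K (ncell y) c.
  move=> i.
  have := ncellP y _ _ (in_cell_center (ncell y) M0) z1 i.
  have := edist_coord y (val z) i.
  have /forallP/(_ i)/andP[] := @in_cell_center R d M (ncell y) M0.
  have /forallP/(_ i)/andP[] := cz.
  rewrite -[in X in _ < X]natr1 -[in X in _ -> _ -> _ < X -> _]natr1.
  set xc := tnth (cell_center _) i; set zi := tnth (val z) i.
  move=> z2 z3 x2 x3 yzi xz.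
  (* In units of the cell side the distance is at most [r * M + 1]; passing to integer indices costs
     one more, whence the hypothesis [r * M + 2 <= K]. *)
  have : `|xc - zi| * M%:R <= (r + M%:R^-1) * M%:R.
    by rewrite ler_pM2r//; lra.
  rewrite mulrDl mulVf ?gt_eqF// -[X in _ * X <= _]gtr0_norm// -normrM.
  rewrite ler_norml.
  move=> /andP[h1 h2].
  by apply/andP; split; rewrite -(ler_nat R) natrD; lra.
by apply: allpairs_f; rewrite mem_enum.
Qed.

End domination_bounds.

(** * Probability that many cells are empty *)

Lemma measurable_box (R : realType) (d : nat) (A : 'I_d -> set R) :
  (forall i, measurable (A i)) ->
  measurable [set x : d.-tuple R | forall i, A i (tnth x i)].
Proof.
move=> mA.
rewrite (_ : [set _ | _] =
    \big[setI/setT]_(i < d) ((@tnth d R ^~ i) @^-1` A i)).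
  apply: bigsetI_measurable => i _.
  by rewrite -[X in measurable X]setTI; exact: measurable_tnth.
rewrite -bigcap_seq; apply/seteqP; split => x /= h.
  by move=> i _; exact: h.
by move=> i; apply: (h i); rewrite /= mem_index_enum.
Qed.

Section random_sample.
Context (R : realType) (d : nat) (dO : measure_display)
  (Omega : measurableType dO) (P : probability Omega R)
  (X : nat -> {RV P >-> d.-tuple R}) (X_indep : mutually_independent X)
  (X_unif : forall i, uniform_on (X i) (cube 1)).
Implicit Types (M n : nat).

Let cell M (c : {ffun 'I_d -> 'I_M}) : set (d.-tuple R) :=
  [set x | in_cell c x].

Let side M (j : 'I_M) : set R :=
  [set` `[j%:R / M%:R - 1 / 2, j%:R / M%:R - 1 / 2 + M%:R^-1[].

Let cellE M (c : {ffun 'I_d -> 'I_M}) : (0 < M)%N ->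
  cell c = [set x | forall i, side (c i) (tnth x i)].
Proof.
move=> M0; have M0' : 0 < M%:R :> R by rewrite ltr0n.
have sideE (j : 'I_M) (x : R) :
    (j%:R / M%:R - 1 / 2 <= x < j%:R / M%:R - 1 / 2 + M%:R^-1) =
    (j%:R <= (x + 1 / 2) * M%:R < j.+1%:R).
  rewrite lerBlDr ler_pdivrMr//; congr andb.
  rewrite -ltr_pdivlMr// -(natr1 j) mulrDl mul1r.
  by apply/idP/idP; lra.
apply/seteqP; split => x /=.
  by move=> /forallP cx i; rewrite /side/= in_itv/= sideE.
move=> cx; apply/forallP => i; rewrite -sideE.
by have := cx i; rewrite /side/= in_itv.
Qed.

Let measurable_cell M (c : {ffun 'I_d -> 'I_M}) : (0 < M)%N ->
  measurable (cell c).
Proof.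
move=> M0; rewrite cellE//.
apply: (@measurable_box _ _ (fun i => side (c i))) => i.
exact: measurable_itv.
Qed.

Let cell_cube M (c : {ffun 'I_d -> 'I_M}) : (0 < M)%N -> cell c `<=` cube 1.
Proof.
move=> M0 x /forallP cx i; have M0' : 0 < M%:R :> R by rewrite ltr0n.
have /andP[x1 x2] := cx i.
have : (tnth x i + 1 / 2) * M%:R < 1 * M%:R.
  by rewrite [ltRHS]mul1r (lt_le_trans x2)// ler_nat.
have : 0 * M%:R <= (tnth x i + 1 / 2) * M%:R.
  by rewrite mul0r (le_trans _ x1).
rewrite ltr_pM2r// ler_pM2r// => h1 h2.
by apply/andP; split; lra.
Qed.

Let prob_cell M (c : {ffun 'I_d -> 'I_M}) k : (0 < M)%N ->
  P (X k @^-1` cell c) = ((M ^ d)%:R^-1)%:E.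
Proof.
move=> M0; have M0' : 0 < M%:R :> R by rewrite ltr0n.
have -> : P (X k @^-1` cell c) = distribution P (X k) (cell c) by [].
rewrite X_unif; last exact: measurable_cell.
rewrite setIidl; last exact: cell_cube.
rewrite lebesgue_tuple_cube1 inve1 mule1 cellE//.
rewrite (lebesgue_tuple_box (fun i => measurable_itv _)).
under eq_bigr => i _.
  rewrite lebesgue_measure_itv/= lte_fin ltrDl invr_gt0 M0'.
  rewrite -EFinB addrAC subrr add0r.
  over.
by rewrite prodEFin prodr_const card_ord natrX exprVn.
Qed.

(** The index set is a finite set of naturals, as in [mutually_independent], so that the probability
    factors at once. *)
Let avoid M (C : {set {ffun 'I_d -> 'I_M}}) n : set Omega :=
  \bigcap_(k in [set` [fset k in iota 0 n]%fset])
    (X k @^-1` ~` \bigcup_(c in [set` C]) cell c).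

Let measurable_cells M (C : {set {ffun 'I_d -> 'I_M}}) : (0 < M)%N ->
  measurable (\bigcup_(c in [set` C]) cell c).
Proof.
by move=> M0; apply: fin_bigcup_measurable => // c _; exact: measurable_cell.
Qed.

Let measurable_avoid M (C : {set {ffun 'I_d -> 'I_M}}) n : (0 < M)%N ->
  measurable (avoid C n).
Proof.
move=> M0; apply: bigcap_measurableType => k _.
apply: measurable_funPTI; apply: measurableC; exact: measurable_cells.
Qed.

Let prob_avoid M (C : {set {ffun 'I_d -> 'I_M}}) n : (0 < M)%N ->
  P (avoid C n) = ((1 - #|C|%:R / (M ^ d)%:R) ^+ n)%:E.
Proof.
move=> M0.
rewrite X_indep; last by move=> _; apply: measurableC; exact: measurable_cells.
have probC k : P (X k @^-1` ~` \bigcup_(c in [set` C]) cell c) =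
    (1 - #|C|%:R / (M ^ d)%:R)%:E.
  have mXcell (c : {ffun 'I_d -> 'I_M}) : measurable (X k @^-1` cell c).
    by apply: measurable_funPTI; exact: measurable_cell.
  have -> : X k @^-1` (~` \bigcup_(c in [set` C]) cell c) =
      ~` \bigcup_(c in [set` C]) (X k @^-1` cell c) by [].
  rewrite probability_setC; last exact: fin_bigcup_measurable.
  rewrite EFinB; congr (_ - _)%E.
  rewrite measure_fin_bigcup//.
  - rewrite (eq_fsbigr (fun=> ((M ^ d)%:R^-1)%:E)); last first.
      by move=> c _; exact: prob_cell.
    rewrite (_ : [set` C] = [set` enum C]); last first.
      by apply/seteqP; split => c /=; rewrite mem_enum.
    rewrite -fsbig_seq ?enum_uniq// sumEFin big_const_seq iter_addr_0.
    by rewrite count_predT -[_ *+ _]mulr_natl -cardE.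
  (* Cells are disjoint, since a point determines its cell by integer parts. *)
  - move=> c c' _ _ [w [/= /forallP cw /forallP c'w]].
    apply/ffunP => i; apply/val_inj.
    by rewrite /= -(truncn_def (cw i)) -(truncn_def (c'w i)).
rewrite (eq_bigr (fun=> (1 - #|C|%:R / (M ^ d)%:R)%:E)); last first.
  by move=> k _; exact: probC.
rewrite prodEFin big_const_seq count_predT iter_mulr_1.
by rewrite -[size _]/(#|` _|) card_fseq undup_id ?iota_uniq// size_iota.
Qed.

Let prob_bigsetU_le (I : Type) (s : seq I) (p : pred I) (F : I -> set Omega)
    (b : R) : 0 <= b ->
  (forall i, measurable (F i)) -> (forall i, p i -> (P (F i) <= b%:E)%E) ->
  (P (\big[setU/set0]_(i <- s | p i) F i) <= ((size s)%:R * b)%:E)%E.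
Proof.
move=> b0 mF Fb; elim: s => [|i s IH]; first by rewrite big_nil measure0 mul0r.
rewrite big_cons /= -natr1 mulrDl mul1r EFinD.
case: ifPn => pi; last by rewrite (le_trans IH)// leeDl// lee_fin.
rewrite (le_trans (measureU2 _ _ _))//; first exact: bigsetU_measurable.
by rewrite addeC leeD// Fb.
Qed.

(* Written as a finite union of avoidance events, so that measurability and the
   union bound are immediate. *)
Definition many_empty_cells M (eps : R) n : set Omega :=
  \big[setU/set0]_(C : {set {ffun 'I_d -> 'I_M}} |
    eps * (M ^ d)%:R <= #|C|%:R) avoid C n.

Lemma many_empty_cellsP M eps n w :
  eps * (M ^ d)%:R <= #|empty_cells (sample X n w) M|%:R ->
  many_empty_cells M eps n w.
Proof.
move=> big; rewrite /many_empty_cells (bigD1 (empty_cells (sample X n w) M))//=.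
left=> k /=; rewrite !inE mem_iota add0n => kn [c /=].
rewrite inE => /existsPn c_empty cX.
have kS : X k w \in sample X n w.
  by apply/imfsetP; exists (Ordinal kn).
by have /negP := c_empty [` kS]%fset; apply.
Qed.

Lemma measurable_many_empty_cells M eps n : (0 < M)%N ->
  measurable (many_empty_cells M eps n).
Proof.
by move=> M0; apply: bigsetU_measurable => C _; exact: measurable_avoid.
Qed.

(** Union bound over all sets of cells, with [1 - x <= exp (- x)] for the proportion [x >= eps] of
    avoided cells. *)
Lemma prob_many_empty_cells M eps n : (0 < M)%N ->
  (P (many_empty_cells M eps n) <=
    ((2 ^ (M ^ d))%:R * expR (- eps) ^+ n)%:E)%E.
Proof.
move=> M0.
have -> : (2 ^ (M ^ d))%N = size (index_enum {set {ffun 'I_d -> 'I_M}}).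
  rewrite -[index_enum _]enumT -cardE -cardsT -powersetT card_powerset cardsT.
  by rewrite card_ffun !card_ord.
apply: prob_bigsetU_le => [||C].
- by rewrite exprn_ge0// expR_ge0.
- by move=> C; exact: measurable_avoid.
move=> epsC; rewrite prob_avoid// lee_fin.
have N0 : 0 < (M ^ d)%:R :> R by rewrite ltr0n expn_gt0 M0.
have CN : #|C|%:R <= (M ^ d)%:R :> R.
  by rewrite ler_nat (leq_trans (max_card _))// card_ffun !card_ord.
rewrite lerXn2r ?nnegrE ?expR_ge0// ?subr_ge0 ?ler_pdivrMr ?mul1r//.
rewrite (le_trans _ (expR_ge1Dx _))// lerD2l lerN2.
by rewrite ler_pdivlMr.
Qed.

End random_sample.

(** * Borel-Cantelli with a geometric bound *)

Section borel_cantelli.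
Context {dO : measure_display} {Omega : measurableType dO} {R : realType}
  (P : probability Omega R).

Lemma eseries_geometric_lty (q : R) : 0 <= q < 1 ->
  (\sum_(n <oo) (q ^+ n)%:E < +oo)%E.
Proof.
move=> /andP[q0 q1].
have cq : cvgn (series (geometric 1 q)).
  by apply: is_cvg_geometric_series; rewrite ger0_norm.
rewrite (_ : (fun n => _) = EFin \o series (geometric 1 q)).
  by rewrite EFin_lim// ltry.
apply/funext => n /=; rewrite sumEFin; congr (_%:E).
by apply: eq_bigr => i _; rewrite /geometric/= mul1r.
Qed.

Lemma ae_eventually_not (F : (set Omega)^nat) (q : R) : 0 <= q < 1 ->
  (forall n, measurable (F n)) ->
  (\forall n \near \oo, (P (F n) <= (q ^+ n)%:E)%E) ->
  {ae P, forall w, \forall n \near \oo, ~ F n w}.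
Proof.
move=> q01 mF [N _ FN]; have /andP[q0 q1] := q01.
(* The bound holds only from [N] on, so the sequence is shifted before summing. *)
pose G n := F (n + N)%N.
have mG n : measurable (G n) by exact: mF.
have limG0 : P (lim_sup_set G) = 0%E.
  apply: lim_sup_set_cvg0 => //.
  apply: le_lt_trans (eseries_geometric_lty q01).
  apply: lee_nneseries => // n _.
  apply: (le_trans (FN (n + N)%N _)); first by rewrite /= leq_addl.
  by rewrite lee_fin exprD ler_piMr ?exprn_ge0// exprn_ile1// ltW.
exists (lim_sup_set G); split => //.
  apply: bigcapT_measurable => n.
  by apply: bigcup_measurable => j _; exact: mG.
move=> w /= nFw n _; apply: contra_notP nFw => nG.
exists (n + N)%N => // m /= nNm Fm; apply: nG.
exists (m - N)%N => /=; first by lia.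
by rewrite /G subnK//; lia.
Qed.

End borel_cantelli.

(** * Almost sure properties of the sample *)

Section uniform_sample.
Context {R : realType} {d : nat} {dO : measure_display}
  {Omega : measurableType dO} {P : probability Omega R}
  {X : nat -> {RV P >-> d.-tuple R}} (X_indep : mutually_independent X)
  (X_unif : forall i, uniform_on (X i) (cube 1)).

Lemma measurable_cube1 : measurable (cube 1 : set (d.-tuple R)).
Proof.
pose I := [set` `[- (1 / 2), 1 / 2[] : set R.
rewrite (_ : cube 1 = [set x | forall i, I (tnth x i)]).
  by apply: (@measurable_box _ _ (fun=> I)) => i; exact: measurable_itv.
by apply/seteqP; split => x x1 i; have := x1 i; rewrite /I /= in_itv.
Qed.

(** The upper bound on the domination number needs the sample inside the cube, which the uniform law
    guarantees only up to a null set. *)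
Lemma ae_sample_cube : {ae P, forall w, forall i, cube 1 (X i w)}.
Proof.
apply/ae_foralln => i; exists (X i @^-1` ~` cube 1); split => //.
  by apply: measurable_funPTI; apply: measurableC; exact: measurable_cube1.
rewrite -[LHS]/(distribution P (X i) (~` cube 1)) X_unif.
  by rewrite setICl measure0 mul0e.
by apply: measurableC; exact: measurable_cube1.
Qed.

(** Eventually [2 ^ (M ^ d) <= exp (eps * n / 2)], so the union bound is at most
    [exp (- eps / 2) ^+ n], which is summable. *)
Lemma ae_few_empty_cells (M : nat -> nat) (eps : R) : 0 < eps ->
  (forall n, (0 < M n)%N) ->
  (\forall n \near \oo, (M n ^ d)%:R <= eps / 2 * n%:R) ->
  {ae P, forall w, \forall n \near \oo,
    #|empty_cells (sample X n w) (M n)|%:R < eps * (M n ^ d)%:R}.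
Proof.
move=> eps0 M0 MN.
have : {ae P, forall w, \forall n \near \oo,
    ~ many_empty_cells X (M n) eps n w}.
  apply: (@ae_eventually_not _ _ _ _ _ (expR (- (eps / 2)))).
  - by rewrite expR_ge0 expR_lt1 oppr_lt0 divr_gt0.
  - by move=> n; exact: measurable_many_empty_cells.
  apply: filterS MN => n MN.
  rewrite (le_trans (prob_many_empty_cells _ _ _ _ _))// lee_fin.
  have two_le : (2 ^ (M n ^ d))%:R <= expR (eps / 2) ^+ n :> R.
    rewrite -expRM_natr natrX.
    rewrite (@le_trans _ _ (expR 1 ^+ (M n ^ d)))//.
      rewrite lerXn2r ?nnegrE ?expR_ge0//.
      by have := @expR_ge1Dx R 1.
    by rewrite -expRM_natr mul1r ler_expR.
  apply: (@le_trans _ _ (expR (eps / 2) ^+ n * expR (- eps) ^+ n)).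
    by rewrite ler_wpM2r// exprn_ge0// expR_ge0.
  by rewrite -exprMn -expRD lerXn2r ?nnegrE ?expR_ge0// ler_expR; lra.
apply: filterS => w; apply: filterS => n nmany.
by rewrite ltNge; apply/negP => /many_empty_cellsP.
Qed.

End uniform_sample.

(** * Passage to the limit *)

(** The range of [n] in which the bounds hold may depend on [k]: first fix [k] with [a k] and [b k]
    close to [L], then let [n] grow. *)
Lemma cvg_squeeze_family {R : realType} (u : nat -> R) (L : R)
    (lo hi : nat -> nat -> R) (a b : nat -> R) :
  a k @[k --> \oo] --> L -> b k @[k --> \oo] --> L ->
  (forall k, lo k n @[n --> \oo] --> a k) ->
  (forall k, hi k n @[n --> \oo] --> b k) ->
  (forall k, \forall n \near \oo, lo k n <= u n <= hi k n) ->
  u n @[n --> \oo] --> L.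
Proof.
move=> aL bL loa hib lou; apply/cvgrPdist_le => e e0.
have [k [ka kb]] : exists k, L - e < a k /\ b k < L + e.
  apply: (@filter_ex _ \oo); near=> k; split; near: k.
    by apply: (cvgr_gt _ aL); rewrite gtrBl.
  by apply: (cvgr_lt _ bL); rewrite ltrDl.
near=> n; rewrite ler_distlC.
have /andP[lo_u u_hi] : lo k n <= u n <= hi k n by near: n; exact: lou.
apply/andP; split.
  rewrite (le_trans _ lo_u)// ltW//; near: n.
  exact: (cvgr_gt _ (loa k)).
rewrite (le_trans u_hi)// ltW//; near: n.
exact: (cvgr_lt _ (hib k)).
Unshelve. all: by end_near. Qed.

(* [slack] is the [eta] of the header.  For [r <= 1], points of a ball of radius
   [r] lie in cells whose indices differ by at most [reach] in each coordinate;
   then [tolerance * mesh ^ d] empty cells, each with its [(2 * reach + 1) ^ d]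
   neighbours, amount to at most [slack * r ^- d] points. *)
Definition slack (R : realType) (k : nat) : R := k.+2%:R^-1.

Definition mesh {R : realType} (d k : nat) (r : R) : nat :=
  (Num.truncn ((d * k.+2)%:R / r)).+1.

Definition reach (d k : nat) : nat := (d * k.+2 + 3)%N.

Definition tolerance (R : realType) (d k : nat) : R :=
  slack R k / (reach d k ^ d * (reach d k).*2.+1 ^ d)%:R.

Section deterministic_limit.
Context {R : realType} {d : nat} {r : nat -> R}
  (r_gt0 : forall n, (0 < n)%N -> 0 < r n) (r_cvg0 : r n @[n --> \oo] --> 0).
Implicit Types (k n : nat).

Local Notation eta := (slack R).

Let eta_gt0 k : 0 < eta k. Proof. by rewrite /slack invr_gt0. Qed.

Let eta_lt1 k : eta k < 1.
Proof. by rewrite /slack invf_lt1 ?ltr0n// ltr1n. Qed.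

Lemma tolerance_gt0 k : 0 < tolerance R d k.
Proof. by rewrite divr_gt0// ltr0n muln_gt0 !expn_gt0 /reach addn3. Qed.

Let cvg_expnN (c : nat -> R) : c k @[k --> \oo] --> (1 : R) ->
  c k ^- d @[k --> \oo] --> (1 : R).
Proof.
move=> c1.
have c2 : c k ^+ d @[k --> \oo] --> (1 ^+ d : R).
  apply: (@continuous_cvg _ _ _ _ _ _ (fun x : R => x ^+ d)) c1.
  exact: exprn_continuous.
have := cvgV _ c2; rewrite expr1n invr1; apply; exact: oner_neq0.
Qed.

Let eta_cvg0 : eta k @[k --> \oo] --> (0 : R).
Proof. by have := @cvg_harmonic R; rewrite -cvg_shiftS. Qed.

(** Substitute [s = (r n * c)^-1], for which [r n ^+ d = c ^- d * s ^- d]. *)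
Let kappa_scaled (c : R) : 0 < c ->
  r n ^+ d * kappa (cube (r n * c)^-1 : set (d.-tuple R)) @[n --> \oo]
    --> c ^- d * kappa_bar R d.
Proof.
move=> c0.
have rc_gt0 : \forall n \near \oo, 0 < r n * c.
  by exists 1%N => // n /= n0; rewrite mulr_gt0// r_gt0.
have rcy : (r n * c)^-1 @[n --> \oo] --> +oo.
  apply/cvgrVy => //; rewrite -(mul0r c).
  by apply: cvgM => //; exact: cvg_cst.
have fk := cvg_comp _ _ rcy (@cvg_kappa_bar R d).
have cc : c ^- d @[_ --> \oo] --> c ^- d by exact: cvg_cst.
apply: (cvg_trans _ (cvgM cc fk)); apply: near_eq_cvg.
near=> n => /=.
have rn : 0 < r n * c by near: n.
rewrite exprVn invrK exprMn !mulrA; congr (_ * _).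
by rewrite mulrAC mulVf ?mul1r// expf_neq0 ?gt_eqF.
Unshelve. all: by end_near. Qed.

(** The mesh exceeds [d * k.+2 / r n] by at most 1. With [r n <= 1] this costs at most 1 in
    [r n * mesh], which together with the 2 gives the 3 in [reach]. *)
Let mesh_bounds k n : 0 < r n -> r n <= 1 ->
  d%:R / (mesh d k (r n))%:R <= r n * eta k /\
  r n * (mesh d k (r n))%:R + 2 <= (reach d k)%:R.
Proof.
move=> rn0 rn1.
have /andP[m1 m2] :
    (Num.truncn ((d * k.+2)%:R / r n))%:R <= (d * k.+2)%:R / r n
      < (mesh d k (r n))%:R.
  by rewrite truncn_itv// divr_ge0// ltW.
split.
  rewrite ler_pdivrMr ?ltr0n// /slack mulrAC ler_pdivlMr ?ltr0n//.
  by move: m2; rewrite ltr_pdivrMr// natrM [_ * r n]mulrC => /ltW.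
move: m1; rewrite ler_pdivlMr// /mesh -natr1 /reach natrD => m1.
rewrite mulrDr mulr1 [r n * _]mulrC; lra.
Qed.

(** The product [r n * mesh] stays below [reach d k], while [n * r n ^+ d] tends to infinity. *)
Lemma few_cells k : n%:R * r n ^+ d @[n --> \oo] --> +oo ->
  \forall n \near \oo, (mesh d k (r n) ^ d)%:R <= tolerance R d k / 2 * n%:R.
Proof.
move=> /cvgryPge/(_ ((reach d k ^ d)%:R / (tolerance R d k / 2))) nr.
near=> n.
have n0 : (0 < n)%N by near: n; exists 1%N.
have rn0 := r_gt0 n0.
have rn1 : r n <= 1 by near: n; apply: (cvgr_le _ r_cvg0).
have [_ rM] := mesh_bounds k rn0 rn1.
have : (reach d k ^ d)%:R / (tolerance R d k / 2) <= n%:R * r n ^+ d by near: n.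
rewrite ler_pdivrMr ?(divr_gt0 (tolerance_gt0 k))// => le_nr.
rewrite -(ler_pM2l (exprn_gt0 d rn0)).
apply: (@le_trans _ _ (reach d k ^ d)%:R); last first.
  by rewrite (le_trans le_nr)// mulrC mulrA [leRHS]mulrC.
rewrite !natrX -exprMn lerXn2r ?nnegrE ?mulr_ge0 ?(ltW rn0)//.
by lra.
Unshelve. all: by end_near. Qed.

(** Purely deterministic: randomness enters only through the hypothesis on empty cells. *)
Lemma cvg_domination (S : nat -> {fset d.-tuple R}) :
  (forall n, [set` S n] `<=` cube 1) ->
  (forall k, \forall n \near \oo,
    #|empty_cells (S n) (mesh d k (r n))|%:R <
      tolerance R d k * (mesh d k (r n) ^ d)%:R) ->
  r n ^+ d * (geom_domination (S n) (r n))%:R @[n --> \oo] --> kappa_bar R d.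
Proof.
move=> S1 Sempty.
pose K s : R := kappa (cube s : set (d.-tuple R)).
apply: (@cvg_squeeze_family _ _ _
  (fun k n => r n ^+ d * K (r n * (1 + eta k))^-1 - eta k)
  (fun k n => r n ^+ d * K (r n * (1 - eta k))^-1 + eta k)
  (fun k => (1 + eta k) ^- d * kappa_bar R d - eta k)
  (fun k => (1 - eta k) ^- d * kappa_bar R d + eta k)).
- rewrite -[X in _ --> X]subr0 -[X in _ --> X - 0]mul1r.
  apply: cvgB => //; apply: cvgM; last exact: cvg_cst.
  apply: cvg_expnN; rewrite -[X in _ --> X]addr0.
  by apply: cvgD => //; exact: cvg_cst.
- rewrite -[X in _ --> X]addr0 -[X in _ --> X + 0]mul1r.
  apply: cvgD => //; apply: cvgM; last exact: cvg_cst.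
  apply: cvg_expnN; rewrite -[X in _ --> X]subr0.
  by apply: cvgB => //; exact: cvg_cst.
- move=> k; apply: cvgB; last exact: cvg_cst.
  by apply: kappa_scaled; rewrite addr_gt0.
- move=> k; apply: cvgD; last exact: cvg_cst.
  by apply: kappa_scaled; rewrite subr_gt0.
move=> k; near=> n.
have n0 : (0 < n)%N by near: n; exists 1%N.
have rn0 := r_gt0 n0.
have rn1 : r n <= 1 by near: n; apply: (cvgr_le _ r_cvg0).
have [dM rM] := mesh_bounds k rn0 rn1.
have rd0 : 0 < r n ^+ d by rewrite exprn_gt0.
have /ltW few : #|empty_cells (S n) (mesh d k (r n))|%:R <
    tolerance R d k * (mesh d k (r n) ^ d)%:R.
  by near: n.
set E := #|empty_cells _ _| in few *.
(* Since [r n * mesh <= reach], the two factors in the denominator of [tolerance] cancel and leave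
   [slack]. *)
have E_le : r n ^+ d * (E * (reach d k).*2.+1 ^ d)%:R <= eta k.
  rewrite natrM mulrA.
  have T0 : 0 < ((reach d k).*2.+1 ^ d)%:R :> R by rewrite ltr0n expn_gt0.
  have Q0 : 0 < (reach d k ^ d)%:R :> R by rewrite ltr0n expn_gt0 /reach addn3.
  rewrite -ler_pdivlMr//.
  apply: (@le_trans _ _ (r n ^+ d *
    (tolerance R d k * (mesh d k (r n) ^ d)%:R))).
    by rewrite ler_pM2l.
  rewrite mulrCA natrX -exprMn.
  apply: (@le_trans _ _ (tolerance R d k * (reach d k ^ d)%:R)).
    rewrite (ler_pM2l (tolerance_gt0 k)) natrX.
    rewrite lerXn2r ?nnegrE ?mulr_ge0 ?(ltW rn0)//.
    by lra.
  by rewrite /tolerance natrM invfM mulrA mulrAC divfK ?gt_eqF// mulrAC.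
have E_le' : r n ^+ d * E%:R <= eta k.
  by rewrite (le_trans _ E_le)// ler_pM2l// ler_nat leq_pmulr// expn_gt0.
apply/andP; split.
  have rho : r n + d%:R / (mesh d k (r n))%:R <= r n * (1 + eta k).
    by rewrite mulrDr mulr1 lerD2l.
  have := kappa_le_domination (S n) (ltn0Sn _ : 0 < mesh d k (r n))%N rn0 rho.
  rewrite -(ler_pM2l rd0) natrD mulrDr -/E /K => le_kappa.
  by lra.
have rho : r n * (1 - eta k) + d%:R / (mesh d k (r n))%:R <= r n.
  by rewrite mulrBr mulr1; lra.
have rho0 : 0 < r n * (1 - eta k) by rewrite mulr_gt0// subr_gt0.
have := @domination_le_kappa R d (S n) _ _ (mesh d k (r n)) (reach d k) isT
  rho0 (S1 n) rho rM.
rewrite -(ler_pM2l rd0) mulrDr -/E /K => le_gamma.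
by rewrite (le_trans le_gamma)// lerD2l.
Unshelve. all: by end_near. Qed.

End deterministic_limit.

Theorem theorem3p4 (R : realType) (d : nat) (d_gt0 : (0 < d)%N)
    (dO : measure_display) (Omega : measurableType dO) (P : probability Omega R)
    (X : nat -> {RV P >-> d.-tuple R})
    (X_indep : mutually_independent X)
    (X_unif : forall i, uniform_on (X i) (cube 1))
    (r : nat -> R)
    (r_gt0 : forall n, (0 < n)%N -> 0 < r n)
    (r_cvg0 : r n @[n --> \oo] --> 0)
    (nr_cvgy : n%:R * r n ^+ d @[n --> \oo] --> +oo) :
  {ae P, forall w,
    r n ^+ d * (geom_domination (sample X n w) (r n))%:R @[n --> \oo]
      --> kappa_bar R d}.
Proof.
have few k := ae_few_empty_cells X_indep X_unif (tolerance_gt0 k)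
  (fun n => ltn0Sn _) (few_cells r_gt0 r_cvg0 k nr_cvgy).
(* As [k] ranges over the naturals, a single null set serves all [k]. *)
apply: filterS2 (ae_sample_cube X_unif) (ae_foralln few) => w w1 wfew.
apply: cvg_domination => // n x /imfsetP[i _ ->]; exact: w1.
Qed.
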